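(* Every right strongly exchange ring is semiregular.
   Context: Rings are associative with identity. $J(R)$ is the Jacobson radical of $R$. A ring $R$ is semiregular if $R/J(R)$ is von Neumann regular and idempotents of $R/J(R)$ can be lifted to idempotents of $R$. A right coprime pair in $R$ is a pair of elements $a,b\in R$ with $aR+bR=R$. Two right coprime pairs $(a,b)$, $(a',b')$ are identified when $aR=a'R$ and $bR=b'R$; $\langle a,b\rangle$ denotes the equivalence class, $\mathrm{RCP}(R)$ the set of all classes, and a pair $(a',b')$ with $\langle a',b'\rangle=\langle a,b\rangle$ is called a pair of generators of $\langle a,b\rangle$. $\mathrm{RCP}(R)$ is partially ordered by $\langle a,b\rangle\le\langle a',b'\rangle$ iff $aR\subseteq a'R$ and $bR\subseteq b'R$. A compatible descending chain of right coprime pairs is a family $\{p_\alpha\mid\alpha<\kappa\}\subseteq \mathrm{RCP}(R)$ ($\kappa$ an ordinal, $p_\beta\le p_\alpha$ for $\alpha<\beta<\kappa$) such that there exist a pair of generators $(a_\alpha,b_\alpha)$ of $p_\alpha$ for each $\alpha<\kappa$, and elements $r_{\alpha\beta},s_{\alpha\beta}\in R$ for $\alpha<\beta<\kappa$, with $a_\beta=a_\alpha r_{\alpha\beta}$ and $b_\beta=b_\alpha s_{\alpha\beta}$ for all $\alpha<\beta<\kappa$, and $r_{\alpha\beta}=r_{\alpha\gamma}r_{\gamma\beta}$, $s_{\alpha\beta}=s_{\alpha\gamma}s_{\gamma\beta}$ for all $\alpha<\gamma<\beta<\kappa$. A minimal lower bound of a chain is a lower bound of the chain in $\mathrm{RCP}(R)$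 that is a minimal element of the poset $\mathrm{RCP}(R)$. The ring $R$ is right strongly exchange if every compatible descending chain of right coprime pairs of $R$ has a minimal lower bound. *)

(* Defs.v *)
From HB Require Import structures.
From mathcomp Require Import all_boot all_order all_algebra.
From mathcomp Require Import generic_quotient ring_quotient.
From mathcomp Require Import boolp classical_sets wochoice.

Set Implicit Arguments.
Unset Strict Implicit.
Unset Printing Implicit Defensive.

Import Order.TTheory GRing.Theory.

Local Open Scope classical_set_scope.
Local Open Scope ring_scope.
Local Open Scope quotient_scope.

(* Rings are [pzRingType]s: associative and unital, not necessarily           *)
(* commutative, the zero ring being allowed.                                  *)

Section JacobsonRadical.
Variable R : pzRingType.
Implicit Types (M N : set R) (x y z r : R).

Definition right_ideal M : Prop :=
  [/\ M 0, forall x y, M x -> M y -> M (x + y)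
         & forall x r, M x -> M (x * r)].

Definition maximal_right_ideal M : Prop :=
  [/\ right_ideal M, M <> setT
    & forall N, right_ideal N -> M `<=` N -> N = M \/ N = setT].

Definition jacobson : set R :=
  \bigcap_(M in [set M | maximal_right_ideal M]) M.

(* The boolean form of the same set, as expected by [Quotient.quot].          *)
Definition jacobson_pred : {pred R} := fun x => x \in jacobson.

Lemma jacobsonP x : reflect (jacobson x) (x \in jacobson_pred).
Proof. by apply: (iffP idP) => [/set_mem|/mem_set]. Qed.

Lemma jacobson_zmod_closed : zmod_closed jacobson_pred.
Proof.
split; first by apply/jacobsonP => M [[]].
move=> x y /jacobsonP Jx /jacobsonP Jy; apply/jacobsonP => M maxM.
have [[_ MD MM] _ _] := maxM; apply: MD; first exact: Jx.
by rewrite -mulrN1; apply: MM; apply: Jy.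
Qed.

HB.instance Definition _ :=
  GRing.isZmodClosed.Build R jacobson_pred jacobson_zmod_closed.

Lemma jacobsonMr x r : x \in jacobson_pred -> x * r \in jacobson_pred.
Proof.
move=> /jacobsonP Jx; apply/jacobsonP => M maxM.
by have [[_ _ MM] _ _] := maxM; apply: MM; apply: Jx.
Qed.

Lemma maximal_right_ideal_colon M r : maximal_right_ideal M -> ~ M r ->
  maximal_right_ideal [set y | M (r * y)].
Proof.
move=> [[M0 MD MM] _ Mmax] nMr; split.
- split=> /= [|x y Mx My|x s Mx]; first by rewrite mulr0.
    by rewrite mulrDr; apply: MD.
  by rewrite mulrA; apply: MM.
- by move=> MT; apply: nMr; rewrite -[r]mulr1 -/([set y | M (r * y)] 1) MT.
move=> N [N0 ND NM] sMN; have [sNM|] := pselect (N `<=` [set y | M (r * y)]).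
  by left; apply/seteqP.
move=> /existsNP[y /not_implyP[Ny nMry]]; right.
have [||EM|ET] := Mmax [set m + r * y * z | m in M & z in setT].
- split=> [|_ _ [m Mm [z _ <-]] [m' Mm' [z' _ <-]]|_ s [m Mm [z _ <-]]].
  + by exists 0 => //; exists 0 => //; rewrite mulr0 addr0.
  + exists (m + m'); first exact: MD.
    by exists (z + z') => //; rewrite mulrDr addrACA.
  + exists (m * s); first exact: MM.
    by exists (z * s) => //; rewrite mulrDl !mulrA.
- by move=> m Mm; exists m => //; exists 0 => //; rewrite mulr0 addr0.
- case: nMry; rewrite /= -EM.
  by exists 0 => //; exists 1 => //; rewrite mulr1 add0r.
have [m Mm [z _ Er]] : [set m + r * y * z | m in M & z in setT] r by rewrite ET.
have N1 : N 1.
  rewrite -(subrK (y * z) 1); apply: ND; last exact: NM.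
  by apply: sMN; rewrite /= mulrBr mulr1 -{1}Er mulrA addrK.
by apply/seteqP; split=> // s _; rewrite -[s]mul1r; apply: NM.
Qed.

Lemma jacobsonMl r x : x \in jacobson_pred -> r * x \in jacobson_pred.
Proof.
move=> /jacobsonP Jx; apply/jacobsonP => M maxM.
have [Mr|nMr] := pselect (M r); first by have [[_ _ MM] _ _] := maxM; apply: MM.
exact: (Jx _ (maximal_right_ideal_colon maxM nMr)).
Qed.

Definition jacobson_quot := Quotient.quot jacobson_pred.

HB.instance Definition _ := GRing.Zmodule.on jacobson_quot.
HB.instance Definition _ : EqQuotient R (Quotient.equiv jacobson_pred)
  jacobson_quot := EqQuotient.on jacobson_quot.

Definition jacobson_quot_one : jacobson_quot := \pi_jacobson_quot 1.
Definition jacobson_quot_mul (x y : jacobson_quot) : jacobson_quot :=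
  \pi_jacobson_quot (repr x * repr y).

Lemma jacobson_quotE x y :
  (\pi_jacobson_quot x == \pi_jacobson_quot y) = (x - y \in jacobson_pred).
Proof. exact/esym/Quotient.idealrBE. Qed.

Lemma pi_jacobson_quot_mul x y :
  jacobson_quot_mul (\pi x) (\pi y) = \pi_jacobson_quot (x * y).
Proof.
apply/eqP; rewrite /jacobson_quot_mul jacobson_quotE.
set x' := repr _; set y' := repr _.
have -> : x' * y' - x * y = (x' - x) * y' + x * (y' - y).
  by rewrite mulrBl mulrBr addrA subrK.
apply: rpredD; [apply: jacobsonMr | apply: jacobsonMl].
  by rewrite -jacobson_quotE reprK.
by rewrite -jacobson_quotE reprK.
Qed.

Lemma pi_jacobson_quotD x y :
  \pi_jacobson_quot x + \pi_jacobson_quot y = \pi_jacobson_quot (x + y).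
Proof. exact/esym/(Quotient.pi_add jacobson_pred). Qed.

Lemma jacobson_quot_mulA : associative jacobson_quot_mul.
Proof.
move=> x y z; rewrite -[x]reprK -[y]reprK -[z]reprK.
by rewrite !pi_jacobson_quot_mul mulrA.
Qed.

Lemma jacobson_quot_mul1 : left_id jacobson_quot_one jacobson_quot_mul.
Proof. by move=> x; rewrite -[x]reprK pi_jacobson_quot_mul mul1r. Qed.

Lemma jacobson_quot_mulr1 : right_id jacobson_quot_one jacobson_quot_mul.
Proof. by move=> x; rewrite -[x]reprK pi_jacobson_quot_mul mulr1. Qed.

Lemma jacobson_quot_mulDl : left_distributive jacobson_quot_mul +%R.
Proof.
move=> x y z; rewrite -[x]reprK -[y]reprK -[z]reprK.
by rewrite pi_jacobson_quotD !pi_jacobson_quot_mul pi_jacobson_quotD mulrDl.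
Qed.

Lemma jacobson_quot_mulDr : right_distributive jacobson_quot_mul +%R.
Proof.
move=> x y z; rewrite -[x]reprK -[y]reprK -[z]reprK.
by rewrite pi_jacobson_quotD !pi_jacobson_quot_mul pi_jacobson_quotD mulrDr.
Qed.

HB.instance Definition _ := GRing.Zmodule_isPzRing.Build jacobson_quot
  jacobson_quot_mulA jacobson_quot_mul1 jacobson_quot_mulr1
  jacobson_quot_mulDl jacobson_quot_mulDr.

Definition jacobson_proj (x : R) : jacobson_quot := \pi_jacobson_quot x.

Lemma jacobson_proj_is_zmod_morphism : zmod_morphism jacobson_proj.
Proof. exact: (pi_is_zmod_morphism (Quotient.quot jacobson_pred)). Qed.

Lemma jacobson_proj_is_monoid_morphism : monoid_morphism jacobson_proj.
Proof.
by split=> // x y; rewrite /jacobson_proj -pi_jacobson_quot_mul.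
Qed.

HB.instance Definition _ := GRing.isZmodMorphism.Build R jacobson_quot
  jacobson_proj jacobson_proj_is_zmod_morphism.
HB.instance Definition _ := GRing.isMonoidMorphism.Build R jacobson_quot
  jacobson_proj jacobson_proj_is_monoid_morphism.

Lemma jacobson_proj_eq0 x : (jacobson_proj x == 0) = (x \in jacobson_pred).
Proof. by rewrite -(rmorph0 jacobson_proj) jacobson_quotE subr0. Qed.

End JacobsonRadical.

Definition von_neumann_regular (R : pzRingType) : Prop :=
  forall a : R, exists x : R, a = a * x * a.

Definition semiregular (R : pzRingType) : Prop :=
  von_neumann_regular (jacobson_quot R) /\
  (forall e : jacobson_quot R, e * e = e ->
     exists2 f : R, f * f = f & jacobson_proj f = e).

Section RightCoprimePairs.
Variable R : pzRingType.

Definition rprincipal (a : R) : set R := [set a * r | r in setT].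

Definition right_coprime (a b : R) : Prop :=
  [set x + y | x in rprincipal a & y in rprincipal b] = setT.

Definition rcpair := {ab : R * R | `[< right_coprime ab.1 ab.2 >]}.

HB.instance Definition _ := Choice.on rcpair.

Definition rcp_equiv (u v : rcpair) : bool :=
  `[< rprincipal (val u).1 = rprincipal (val v).1 /\
      rprincipal (val u).2 = rprincipal (val v).2 >].

Lemma rcp_equiv_is_equiv : equiv_class_of rcp_equiv.
Proof.
split=> [u|u v|v u w]; rewrite /rcp_equiv; first exact/asboolP.
  by apply: asbool_equiv_eq; split=> -[-> ->].
by move=> /asboolP[-> ->] /asboolP[-> ->]; apply/asboolP.
Qed.

Canonical rcp_equiv_rel := EquivRelPack rcp_equiv_is_equiv.
Canonical rcp_equiv_encModRel := defaultEncModRel rcp_equiv.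

Definition RCP := {eq_quot rcp_equiv}.

HB.instance Definition _ : EqQuotient rcpair rcp_equiv RCP := EqQuotient.on RCP.
HB.instance Definition _ := Choice.on RCP.

Definition rcpair_le (u v : rcpair) : Prop :=
  rprincipal (val u).1 `<=` rprincipal (val v).1 /\
  rprincipal (val u).2 `<=` rprincipal (val v).2.

Definition rcp_le (p q : RCP) : bool := `[< rcpair_le (repr p) (repr q) >].

Lemma rcp_le_refl : reflexive rcp_le.
Proof. by move=> p; apply/asboolP; split. Qed.

Lemma rcp_le_anti : antisymmetric rcp_le.
Proof.
move=> p q /andP[/asboolP[pq1 pq2] /asboolP[qp1 qp2]].
rewrite -[p]reprK -[q]reprK; apply/eqP; rewrite piE; apply/asboolP.
by split; apply/seteqP.
Qed.

Lemma rcp_le_trans : transitive rcp_le.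
Proof.
move=> q p r /asboolP[pq1 pq2] /asboolP[qr1 qr2]; apply/asboolP.
by split; [apply: subset_trans qr1 | apply: subset_trans qr2].
Qed.

HB.instance Definition _ := Order.Le_isPOrder.Build (Order.Disp tt tt) RCP
  rcp_le_refl rcp_le_anti rcp_le_trans.

(* The order on classes does not depend on the choice of generators.          *)
Lemma rcp_leP (u v : rcpair) :
  reflect (rcpair_le u v) (\pi_RCP u <= \pi_RCP v)%O.
Proof.
have reprE w : rprincipal (val (repr (\pi_RCP w))).1 = rprincipal (val w).1 /\
               rprincipal (val (repr (\pi_RCP w))).2 = rprincipal (val w).2.
  by apply/asboolP; have /eqP := reprK (\pi_RCP w); rewrite piE.
have [u1 u2] := reprE u; have [v1 v2] := reprE v.
by apply: (iffP (asboolP _)); rewrite /rcpair_le u1 u2 v1 v2.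
Qed.

End RightCoprimePairs.

Section StronglyExchange.
Variable R : pzRingType.

(* An ordinal is represented by an arbitrary well-ordered index type [I].     *)
(* The generators [g i] of [p i] come with their coprimality; the values of   *)
(* [r] and [s] at indices that are not strictly increasing are irrelevant.    *)
Definition compatible_descending_chain (d : Order.disp_t) (I : orderType d)
    (p : I -> RCP R) : Prop :=
  (forall i j : I, (i < j)%O -> (p j <= p i)%O) /\
  exists (g : I -> rcpair R) (r s : I -> I -> R),
    [/\ forall i : I, \pi_(RCP R) (g i) = p i,
        forall i j : I, (i < j)%O ->
          (val (g j)).1 = (val (g i)).1 * r i j /\
          (val (g j)).2 = (val (g i)).2 * s i j
      & forall i k j : I, (i < k)%O -> (k < j)%O ->
          r i j = r i k * r k j /\ s i j = s i k * s k j].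

(* Minimality is in the whole poset [RCP R], not among the lower bounds.      *)
Definition minimal_lower_bound (I : Type) (p : I -> RCP R) (m : RCP R) : Prop :=
  (forall i : I, (m <= p i)%O) /\ (forall q : RCP R, (q <= m)%O -> q = m).

Definition right_strongly_exchange : Prop :=
  forall (d : Order.disp_t) (I : orderType d) (p : I -> RCP R),
    well_order (<=%O : rel I) -> compatible_descending_chain p ->
    exists m : RCP R, minimal_lower_bound p m.

End StronglyExchange.

(* Main.v *)
(* Let a + b = 1 generate a minimal element of RCP(R).  Comparison with       *)
(* <a^2, b> gives a = a^2 x, comparison with <a x, 1 - a x> then gives        *)
(* ab = 0: minimal elements have the form <e, 1 - e> with e idempotent.  So R *)
(* is exchange, idempotents lift modulo J(R), and right ideals outside J(R)   *)
(* contain nonzero idempotents.                                               *)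
(* Fix a and preorder the idempotents e of aR by inclusion of the left        *)
(* ideals Re.  An increasing well-ordered chain (e_i) yields the compatible   *)
(* chain <1 - e_i, a> with r_ij = 1 - e_j and s_ij = 1; a minimal lower bound *)
(* <1 - e, e> of it provides an upper bound e of the e_i in aR.  By Zorn's    *)
(* lemma there is a maximal e = ax.  If (1 - e)a were not in J(R), a nonzero  *)
(* idempotent g of (1 - e)aR would give the larger idempotent e + g(1 - e) of *)
(* aR; hence a - axa is in J(R).                                              *)
Require Import Defs.
From HB Require Import structures.
From mathcomp Require Import all_boot all_order all_algebra.
From mathcomp Require Import generic_quotient.
From mathcomp Require Import boolp classical_sets wochoice.

Set Implicit Arguments.
Unset Strict Implicit.
Unset Printing Implicit Defensive.

Import Order.TTheory GRing.Theory.

Local Open Scope classical_set_scope.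
Local Open Scope ring_scope.
Local Open Scope quotient_scope.

(** A minimal element of RCP(R) comes from an idempotent and its complement
    ([minimal_rcp_idempotent]), so lower bounds of chains produce idempotents. One-term chains give
    the exchange property, hence lifting ([lift_idempotent_jacobson]) and nonzero idempotents in xR
    for x outside J(R) ([notin_jacobson_idempotent]). Longer chains bound chains of idempotents of
    aR ([idempotent_wo_chain_ub]), so Zorn gives a maximal one e = ax, and maximality puts a - axa
    in J(R) ([maximal_idempotent_jacobson]). *)

Section WellOrderedChainType.
Variables (T : choiceType) (le : rel T) (C : {pred T}).

(* The proof argument only serves to attach the order structure.              *)
Definition wo_chain_type of wo_chain le C : Type := {x : T | x \in C}.

Variable woC : wo_chain le C.
Local Notation I := (wo_chain_type woC).

HB.instance Definition _ := Choice.on I.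

Definition wo_chain_le (x y : I) : bool := le (val x) (val y).

Lemma wo_chain_le_refl : reflexive wo_chain_le.
Proof. by move=> x; apply: (wo_chain_reflexive woC); apply: valP. Qed.

Lemma wo_chain_le_anti : antisymmetric wo_chain_le.
Proof.
move=> x y le_xy; apply/val_inj/(wo_chain_antisymmetric woC) => //.
  exact: valP.
exact: valP.
Qed.

Lemma wo_chain_le_wo : well_order wo_chain_le.
Proof.
apply: (antisymmetric_well_order wo_chain_le_anti) => A [x Ax].
(* [B] is the image of [A] in [T]; the default [false] excludes the points outside [C]. *)
pose B := [pred y | oapp (mem A) false (insub y : option {y : T | y \in C})].
have sBC : {subset B <= C} by move=> y; rewrite inE /=; case: insubP.
have BE (z : I) : (val z \in B) = (z \in A) by rewrite inE /= valK.
have [|z [[Bz lbz] _]] := woC sBC; first by exists (val x); rewrite BE.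
exists (Sub z (sBC _ Bz)); split; first by rewrite -BE.
by move=> y Ay; apply: lbz; rewrite BE.
Qed.

Lemma wo_chain_le_total : total wo_chain_le.
Proof. by move=> x y; apply: (wo_chainW woC); apply: valP. Qed.

(** Transitivity comes from the well-order: the least element of {x, y, z} is x, or antisymmetry
    identifies y with x or with z. *)
Lemma wo_chain_le_trans : transitive wo_chain_le.
Proof.
have woT : wo_chain wo_chain_le predT by move=> A _; apply: wo_chain_le_wo.
move=> y x z le_xy le_yz.
pose A := [pred t : I | [|| t == x, t == y | t == z]].
have [|t [[At lbt] _]] := wo_chain_le_wo (A := A).
  by exists x; rewrite inE eqxx.
have [tx ty tz] : [/\ wo_chain_le t x, wo_chain_le t y & wo_chain_le t z].
  by split; apply: lbt; rewrite inE eqxx ?orbT.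
move: At; rewrite inE => /or3P[]/eqP Et; rewrite Et in tx ty tz => //.
  by rewrite (wo_chain_le_anti (x := x) (y := y)) ?le_xy.
by rewrite -(wo_chain_le_anti (x := y) (y := z)) ?le_yz.
Qed.

HB.instance Definition _ := Order.Le_isPOrder.Build (Order.Disp tt tt) I
  wo_chain_le_refl wo_chain_le_anti wo_chain_le_trans.

HB.instance Definition _ := Order.POrder_isTotal.Build (Order.Disp tt tt) I
  wo_chain_le_total.

End WellOrderedChainType.

(** * Minimal coprime pairs and idempotents *)

Section RingLemmas.
Variable R : pzRingType.
Implicit Types (a b e f g x y : R).

Lemma right_coprimeP a b :
  right_coprime a b <-> exists r s, a * r + b * s = 1.
Proof.
split=> [cop|[r [s E]]].
  have [_ [r _ <-] [_ [s _ <-]] E] :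
    [set x + y | x in rprincipal a & y in rprincipal b] 1 by rewrite cop.
  by exists r, s.
apply/seteqP; split=> // x _; exists (a * (r * x)); first by exists (r * x).
by exists (b * (s * x)); [exists (s * x) | rewrite !mulrA -mulrDl E mul1r].
Qed.

Definition mk_rcpair a b (cop : right_coprime a b) : rcpair R :=
  exist _ (a, b) (asboolT cop).

Lemma rprincipal_refl a : rprincipal a a.
Proof. by exists 1; rewrite ?mulr1. Qed.

Lemma rprincipalM a x r : rprincipal a x -> rprincipal a (x * r).
Proof. by move=> [s _ <-]; exists (s * r); rewrite ?mulrA. Qed.

Lemma rprincipalD a x y :
  rprincipal a x -> rprincipal a y -> rprincipal a (x + y).
Proof. by move=> [r _ <-] [s _ <-]; exists (r + s); rewrite ?mulrDr. Qed.

Lemma rprincipalB a x y :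
  rprincipal a x -> rprincipal a y -> rprincipal a (x - y).
Proof. by move=> [r _ <-] [s _ <-]; exists (r - s); rewrite ?mulrBr. Qed.

Lemma rprincipal_sub a b : rprincipal b a -> rprincipal a `<=` rprincipal b.
Proof. by move=> ba _ [r _ <-]; apply: rprincipalM. Qed.

Lemma minimal_rcp_idempotent (m : RCP R) :
    (forall q : RCP R, (q <= m)%O -> q = m) ->
  exists2 e, e * e = e & forall u : rcpair R, (m <= \pi_(RCP R) u)%O ->
    rprincipal (val u).1 e /\ rprincipal (val u).2 (1 - e).
Proof.
rewrite -[m]reprK; move: (repr m) => v minv.
(* By minimality, a coprime pair inside [v] generates the same class. *)
have minP x y : right_coprime x y ->
    rprincipal (val v).1 x -> rprincipal (val v).2 y ->
    rprincipal x (val v).1 /\ rprincipal y (val v).2.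
  move=> cop vx vy; pose w := mk_rcpair cop.
  have le_wv : (\pi_(RCP R) w <= \pi_(RCP R) v)%O.
    by apply/rcp_leP; split; apply: rprincipal_sub.
  have /rcp_leP[wv1 wv2] : (\pi_(RCP R) v <= \pi_(RCP R) w)%O.
    by rewrite (minv _ le_wv).
  by split; [apply: wv1 | apply: wv2]; apply: rprincipal_refl.
have [r [s]] := (right_coprimeP _ _).1 (asboolW (valP v)).
move aE : (_ * r) => a; move bE : (_ * s) => b => abE.
have va : rprincipal (val v).1 a by exists r.
have vb : rprincipal (val v).2 b by exists s.
have b1E : b = 1 - a by rewrite -abE addrC addKr.
have cop2 : right_coprime (a * a) b.
  (* With b = 1 - a, b(1 + a) = 1 - a^2. *)
  apply/right_coprimeP; exists 1, (1 + a).
  by rewrite b1E mulr1 mulrDr mulr1 mulrBl mul1r addrC addrA subrK subrK.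
have [|[t _ Et] _] := minP _ _ cop2 _ vb; first exact: rprincipalM.
(* Multiplying [Et] on the right by [r] gives a^2 x = a. *)
pose x := t * r.
have axE : a * (1 - a * x) = 0.
  by rewrite mulrBr mulr1 /x !mulrA Et aE subrr.
have vb' : rprincipal (val v).2 (1 - a * x).
  have -> : 1 - a * x = b * (1 - a * x) by rewrite b1E mulrBl mul1r axE subr0.
  exact: rprincipalM.
have cop3 : right_coprime (a * x) (1 - a * x).
  by apply/right_coprimeP; exists 1, 1; rewrite !mulr1 addrC subrK.
have [_ [z _ Ez]] := minP _ _ cop3 (rprincipalM _ va) vb'.
have ab0 : a * b = 0 by rewrite -bE -Ez -mulrA mulrA axE mul0r.
exists a; first by rewrite -[RHS]mulr1 -abE mulrDr ab0 addr0.
by move=> u /rcp_leP[vu1 vu2]; rewrite -b1E; split; [apply: vu1 | apply: vu2].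
Qed.

End RingLemmas.

(** For b = 1 - a this is the Goodearl-Nicholson criterion for exchange rings. *)
Definition right_exchange (R : pzRingType) : Prop :=
  forall a b : R, right_coprime a b ->
  exists e, [/\ e * e = e, rprincipal a e & rprincipal b (1 - e)].

Lemma strongly_exchange_exchange (R : pzRingType) :
  right_strongly_exchange R -> right_exchange R.
Proof.
move=> sxR a b cop; pose u := mk_rcpair cop.
have wo1 : well_order (<=%O : rel 'I_1).
  move=> A [i Ai]; exists i; split=> [|j _]; last by rewrite (ord1 i) (ord1 j).
  by split=> // j _; rewrite (ord1 i) (ord1 j).
(* A one-term chain is trivially compatible, so a minimal element lies below <a, b>. *)
have [|m [lbm minm]] := sxR _ 'I_1 (fun=> \pi_(RCP R) u) wo1.
  split=> //; exists (fun=> u), (fun _ _ => 1), (fun _ _ => 1).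
  by split=> // i j; rewrite (ord1 i) (ord1 j) ltxx.
have [e ee /(_ u (lbm ord0))[ae be]] := minimal_rcp_idempotent minm.
by exists e.
Qed.

(** * Idempotents and the radical of an exchange ring *)

Section Exchange.
Variable R : pzRingType.
Hypothesis xR : right_exchange R.
Implicit Types (a e f g x y : R).

(** A maximal right ideal M missing x has M + xR = R. Exchange on 1 = m + y gives g in yR with 1 - g
    in M, so g = 0 would put 1 in M. *)
Lemma notin_jacobson_idempotent x : x \notin @jacobson_pred R ->
  exists g, [/\ g * g = g, rprincipal x g & g != 0].
Proof.
move=> /jacobsonP /existsNP[M /not_implyP[[[M0 MD MM] Mproper Mmax] nMx]].
have nM1 : ~ M 1.
  move=> M1; apply: Mproper; apply/seteqP; split=> // y _.
  by rewrite -[y]mul1r; apply: MM.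
pose N := [set m + y | m in M & y in rprincipal x].
have [||EN|EN] := Mmax N.
- split=> [|_ _ [m Mm [y xy <-]] [m' Mm' [y' xy' <-]]|_ s [m Mm [y xy <-]]].
  + by exists 0 => //; exists 0; rewrite ?addr0 //; exists 0; rewrite ?mulr0.
  + exists (m + m'); first exact: MD.
    by exists (y + y'); [apply: rprincipalD | rewrite addrACA].
  + exists (m * s); first exact: MM.
    by exists (y * s); [apply: rprincipalM | rewrite mulrDl].
- move=> m Mm; exists m => //; exists 0; rewrite ?addr0 //.
  by exists 0; rewrite ?mulr0.
- case: nMx; rewrite -EN; exists 0 => //; exists x; rewrite ?add0r //.
  exact: rprincipal_refl.
have [m Mm [y xy E1]] : N 1 by rewrite EN.
have [|g [gg yg [s _ Es]]] := @xR y m.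
  by apply/right_coprimeP; exists 1, 1; rewrite !mulr1 addrC.
exists g; split=> //; first exact: rprincipal_sub yg.
apply/eqP => g0; apply: nM1; rewrite -[1]subr0 -g0 -Es; exact: MM.
Qed.

Lemma lift_idempotent_jacobson (e : jacobson_quot R) : e * e = e ->
  exists2 f : R, f * f = f & jacobson_proj f = e.
Proof.
have [a <-] : exists a : R, jacobson_proj a = e.
  by exists (repr e); apply: reprK.
move=> ee.
have [|f [ff [r _ fE] [s _ f1E]]] := @xR a (1 - a).
  by apply/right_coprimeP; exists 1, 1; rewrite !mulr1 addrC subrK.
exists f => //; pose p : {rmorphism R -> jacobson_quot R} := @jacobson_proj R.
(* Modulo J(R), f in aR gives af = f, and 1 - f in (1 - a)R gives af = a. *)
have pf : p f = p a * p f by rewrite -{1 2}fE !rmorphM mulrA ee.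
have : p a * p (1 - f) = 0.
  by rewrite -f1E rmorphM rmorphB rmorph1 mulrA mulrBr mulr1 ee subrr mul0r.
by rewrite rmorphB rmorph1 mulrBr mulr1 -pf => /eqP; rewrite subr_eq0 => /eqP.
Qed.

End Exchange.

(** * Maximal idempotents of aR *)

Section StronglyExchange.
Variable R : pzRingType.
Hypothesis sxR : right_strongly_exchange R.
Implicit Types (a e f g x : R).

Let idem_le : rel R := fun e f => e * f == e.

Lemma idempotent_wo_chain_ub a (C : {pred R}) : wo_chain idem_le C ->
    {in C, forall e, e * e = e /\ rprincipal a e} ->
  exists e, [/\ e * e = e, rprincipal a e & {in C, forall f, f * e = f}].
Proof.
move=> woC CP.
(* An empty chain is bounded by 0; otherwise [i0] supplies a pair from which membership in aR is
   read off. *)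
have [[i0 Ci0]|C0] := pselect (nonempty C); last first.
  exists 0; split=> [||f Cf]; first by rewrite mulr0.
    by exists 0; rewrite ?mulr0.
  by case: C0; exists f.
pose I : orderType _ := wo_chain_type woC.
have leI (i j : I) : (i < j)%O -> val i * val j = val i.
  by move=> /ltW lij; apply/eqP; exact: lij.
have cop (i : I) : right_coprime (1 - val i) a.
  have [_ [x _ ax]] := CP _ (valP i).
  by apply/right_coprimeP; exists 1, x; rewrite mulr1 ax subrK.
(* Complements reverse the order; this one identity gives both the factorization of generators and
   the cocycle condition. *)
have complM (i j : I) : (i < j)%O -> (1 - val i) * (1 - val j) = 1 - val j.
  by move=> /leI Eij; rewrite mulrBl mul1r mulrBr mulr1 Eij subrr subr0.
pose g i := mk_rcpair (cop i).
have [||m [lbm minm]] := sxR (p := fun i : I => \pi_(RCP R) (g i)).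
- exact: wo_chain_le_wo.
- split=> [i j lij|].
    apply/rcp_leP; split=> //=; apply: rprincipal_sub.
    by exists (1 - val j) => //; apply: complM.
  exists g, (fun _ j => 1 - val j), (fun _ _ => 1).
  split=> // [i j lij|i k j _ lkj] /=; first by rewrite complM ?mulr1.
  by rewrite complM ?mulr1.
have [f ff lef] := minimal_rcp_idempotent minm.
exists (1 - f); split.
- by rewrite mulrBr mulr1 mulrBl mul1r ff subrr subr0.
- by have [_] := lef _ (lbm (Sub i0 Ci0)).
move=> e Ce; pose i : I := Sub e Ce.
have [[r _ fE] _] := lef _ (lbm i).
have [ee _] := CP e Ce.
(* f lies in (1 - e)R, which e annihilates from the left. *)
have ef0 : e * f = 0 by rewrite -fE mulrA mulrBr mulr1 ee subrr mul0r.
by rewrite mulrBr mulr1 ef0 subr0.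
Qed.

Lemma maximal_idempotent a : exists e, [/\ e * e = e, rprincipal a e
  & forall f, f * f = f -> rprincipal a f -> e * f = e -> f * e = f].
Proof.
pose S : {pred R} := fun e => `[< e * e = e /\ rprincipal a e >].
have [|||e /asboolP[ee ae] maxe] := @Zorn's_lemma R idem_le S.
- by move=> e /asboolP[ee _]; apply/eqP.
- move=> f e g _ _ _ /eqP ef /eqP fg; apply/eqP.
  by rewrite -ef -mulrA fg.
- move=> C sCS woC.
  have [|e [ee ae ub]] := idempotent_wo_chain_ub (a := a) woC.
    by move=> e /sCS/asboolP.
  by exists e => [|f Cf]; [apply/asboolP | apply/eqP/ub].
exists e; split=> // f ff af ef; apply/eqP/maxe; last exact/eqP.
exact/asboolP.
Qed.

Lemma maximal_idempotent_jacobson a e : e * e = e -> rprincipal a e ->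
    (forall f, f * f = f -> rprincipal a f -> e * f = e -> f * e = f) ->
  (1 - e) * a \in @jacobson_pred R.
Proof.
move=> ee ae maxe; apply/negPn/negP => nJ.
have [g [gg [r _ gE]]] :=
  notin_jacobson_idempotent (strongly_exchange_exchange sxR) nJ.
apply/negP/negPn/eqP.
have eg0 : e * g = 0.
  by rewrite -gE !mulrA mulrBr mulr1 ee subrr !mul0r.
have ag : rprincipal a g.
  rewrite -gE mulrBl mul1r; apply/rprincipalM/rprincipalB.
    exact: rprincipal_refl.
  exact: rprincipalM.
(* Since eg = 0, e + g(1 - e) is an idempotent of aR above e. *)
pose f := e + (g - g * e).
have ef : e * f = e by rewrite mulrDr ee mulrBr mulrA eg0 mul0r subrr addr0.
have gf : g * f = g by rewrite mulrDr mulrBr mulrA gg addrC subrK.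
have fe : f * e = e by rewrite mulrDl mulrBl ee -mulrA ee subrr addr0.
have ff : f * f = f by rewrite {1}/f mulrDl mulrBl -mulrA ef gf.
have af : rprincipal a f.
  by apply: rprincipalD => //; apply: rprincipalB => //; apply: rprincipalM.
(* Maximality gives fe = f while fe = e. Then g = gf = ge, so g = g^2 = geg = 0. *)
have Ef : f = e by rewrite -(maxe f ff af ef) fe.
by rewrite -gg -{1}gf Ef -mulrA eg0 mulr0.
Qed.

End StronglyExchange.

Theorem theorem4p3 (R : pzRingType) :
  right_strongly_exchange R -> semiregular R.
Proof.
move=> sxR; split; last first.
  exact/lift_idempotent_jacobson/strongly_exchange_exchange.
move=> abar; pose p : {rmorphism R -> jacobson_quot R} := @jacobson_proj R.
have [a <-] : exists a : R, p a = abar by exists (repr abar); apply: reprK.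
have [e [ee ae maxe]] := maximal_idempotent sxR a.
have := maximal_idempotent_jacobson sxR ee ae maxe.
have [x _ ax] := ae; rewrite -jacobson_proj_eq0 => Ja.
(* As e = ax, the element (1 - e)a of J(R) is a - axa. *)
exists (p x); apply/eqP; rewrite -!rmorphM ax -subr_eq0 -rmorphB.
by rewrite -{1}[a]mul1r -mulrBl.
Qed.
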